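(* Let $E$ be a $JC^*$-triple. Then there is a pair $(C^*(E), \alpha_E)$, where $C^*(E)$ is a $C^*$-algebra and $\alpha_E \colon E \to C^*(E)$ is an injective triple homomorphism, with the following properties: (a) $\alpha_E(E)$ generates $C^*(E)$ as a $C^*$-algebra; (b) for each triple homomorphism $\pi \colon E \to A$, where $A$ is a $C^*$-algebra, there is a unique $*$-homomorphism $\tilde{\pi} \colon C^*(E) \to A$ with $\tilde{\pi} \circ \alpha_E = \pi$. Moreover, the pair is unique up to natural equivalence with $*$-isomorphism: if $(B, \beta)$ is another such pair then there is a $*$-isomorphism $\theta \colon C^*(E) \to B$ with $\theta \circ \alpha_E = \beta$.
   Context: A TRO (ternary ring of operators) is a norm closed subspace of a $C^*$-algebra that is closed under the ternary product $[a,b,c] = ab^*c$. A $JC^*$-subtriple of a TRO is a norm closed subspace $F$ closed under the triple product $\{a,b,c\} = \tfrac12(ab^*c + cb^*a)$. A $JC^*$-triple is a complex Banach space $E$ for which there is a surjective linear isometry $\phi \colon F \to E$ with $F$ a $JC^*$-subtriple of a TRO; the triple product on $E$ given by $\{\phi(a),\phi(b),\phi(c)\} = \phi(\{a,b,c\})$ is independent of $F$ and $\phi$. A triple homomorphism is a linear map preserving the triple product; a $C^*$-algebra is regarded as a $JC^*$-triple with $\{a,b,c\} = \tfrac12(ab^*c + cb^*a)$. *)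

(* Defs.v *)
From HB Require Import structures.
From mathcomp Require Import all_boot all_order all_algebra complex.
From mathcomp Require Import all_classical all_reals all_analysis.
Import Order.TTheory GRing.Theory Num.Theory.
Import numFieldNormedType.Exports.

Set Implicit Arguments.
Unset Strict Implicit.
Unset Printing Implicit Defensive.

Local Open Scope classical_set_scope.
Local Open Scope ring_scope.
Local Open Scope complex_scope.

Declare Scope cstar_scope.
Delimit Scope cstar_scope with cstar.
Reserved Notation "x ** y" (at level 40, left associativity).

(* C*-algebras over the complex numbers R[i] are not required to be unital, so
   the multiplication is not the one of a (unital) MathComp ring. *)
HB.mixin Record isCStarAlgebra (R : realType) A
    of CompleteNormedModule R[i] A := {
  cmul : A -> A -> A ;
  star : A -> A ;
  cmulA : associative cmul ;
  cmul_linearl : forall (a : R[i]) (x y z : A),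
    cmul (a *: x + y) z = a *: cmul x z + cmul y z ;
  cmul_linearr : forall (a : R[i]) (x y z : A),
    cmul z (a *: x + y) = a *: cmul z x + cmul z y ;
  star_conj_linear : forall (a : R[i]) (x y : A),
    star (a *: x + y) = a^* *: star x + star y ;
  starK : involutive star ;
  star_cmul : forall x y : A, star (cmul x y) = cmul (star y) (star x) ;
  cmul_norm_le : forall x y : A, `|cmul x y| <= `|x| * `|y| ;
  cstar_identity : forall x : A, `|cmul (star x) x| = `|x| ^+ 2
}.

#[short(type="cstarAlgType")]
HB.structure Definition CStarAlgebra (R : realType) :=
  {A of isCStarAlgebra R A & CompleteNormedModule R[i] A}.

Notation "x ** y" := (cmul x y) : cstar_scope.
Local Open Scope cstar_scope.

Definition cstar_triple (R : realType) (A : cstarAlgType R) (a b c : A) : A :=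
  2^-1 *: (a ** star b ** c + c ** star b ** a).

Definition closed_subspace (R : realType) (V : completeNormedModType R[i])
    (S : set V) : Prop :=
  [/\ S 0, (forall (a : R[i]) (x y : V), S x -> S y -> S (a *: x + y))
    & closed S].

Definition is_TRO (R : realType) (A : cstarAlgType R) (T : set A) : Prop :=
  closed_subspace T /\
  forall a b c, T a -> T b -> T c -> T (a ** star b ** c).

(* T is closed in A whenever it is a TRO, so closedness of F in T and in A
   agree. *)
Definition is_JC_subtriple (R : realType) (A : cstarAlgType R) (T F : set A) :
    Prop :=
  [/\ F `<=` T, closed_subspace F
    & forall a b c, F a -> F b -> F c -> F (cstar_triple a b c)].

(* phi is only meaningful on F: it restricts to a linear isometry of F onto E
   which carries the triple product of F to tp. *)
Definition is_JC_realization (R : realType) (E : completeNormedModType R[i])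
    (tp : E -> E -> E -> E) (A : cstarAlgType R) (F : set A) (phi : A -> E) :
    Prop :=
  [/\ forall (a : R[i]) (x y : A), F x -> F y ->
        phi (a *: x + y) = a *: phi x + phi y,
      forall x, F x -> `|phi x| = `|x|,
      phi @` F = setT
    & forall a b c, F a -> F b -> F c ->
        tp (phi a) (phi b) (phi c) = phi (cstar_triple a b c)].

(* The triple product of a JC*-triple is determined by its Banach space; it is
   carried as an operation, required to come from some realization. *)
HB.mixin Record isJCTriple (R : realType) E
    of CompleteNormedModule R[i] E := {
  jctriple : E -> E -> E -> E ;
  jctriple_realizable : exists (A : cstarAlgType R) (T F : set A) (phi : A -> E),
    [/\ is_TRO T, is_JC_subtriple T F & is_JC_realization jctriple F phi]
}.

#[short(type="jcTripleType")]
HB.structure Definition JCTriple (R : realType) :=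
  {E of isJCTriple R E & CompleteNormedModule R[i] E}.

Definition is_triple_hom (R : realType) (E : jcTripleType R)
    (A : cstarAlgType R) (f : E -> A) : Prop :=
  linear f /\
  forall a b c, f (jctriple a b c) = cstar_triple (f a) (f b) (f c).

Definition is_star_hom (R : realType) (A B : cstarAlgType R) (f : A -> B) :
    Prop :=
  [/\ linear f, {morph f : x y / x ** y} & {morph f : x / star x}].

Definition is_star_iso (R : realType) (A B : cstarAlgType R) (f : A -> B) :
    Prop :=
  is_star_hom f /\ bijective f.

Definition is_cstar_subalgebra (R : realType) (A : cstarAlgType R)
    (S : set A) : Prop :=
  [/\ closed_subspace S, (forall x y, S x -> S y -> S (x ** y))
    & (forall x, S x -> S (star x))].

Definition cstar_generated (R : realType) (A : cstarAlgType R) (G : set A) :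
    set A :=
  smallest (@is_cstar_subalgebra R A) G.

Definition is_universal_cstar (R : realType) (E : jcTripleType R)
    (C : cstarAlgType R) (alpha : E -> C) : Prop :=
  [/\ is_triple_hom alpha /\ injective alpha,
      cstar_generated (range alpha) = setT
    & forall (A : cstarAlgType R) (f : E -> A), is_triple_hom f ->
        exists! g : C -> A, is_star_hom g /\ g \o alpha = f].

(* Main.v *)
(* Triple homomorphisms into C*-algebras are contractive: otherwise scale so that
   |f x| = 1 > |x| and let p = (f x)^* (f x).  The equation y = x + {x,{x,x,x},y}
   is solvable in E by a Neumann series, but its image cannot be solved, because
   1 is an approximate eigenvalue of p^2.

   Consequently the *-polynomials in elements of E, evaluated through a triple
   homomorphism, are bounded independently of the homomorphism, and C*(E) is the
   closed *-subalgebra generated by E in the l^oo-product of a small family of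
   C*-algebras that realizes every seminorm t |-> |t(f)|.  A triple homomorphism
   f factors through the coordinate inducing the same seminorm, since the map
   between the values of *-polynomials is isometric and hence extends to the
   closure.  Injectivity holds because E itself is realized in a C*-algebra. *)

Require Import Defs.
From HB Require Import structures.
From mathcomp Require Import all_boot all_order all_algebra complex.
From mathcomp Require Import all_classical all_reals all_analysis.
From mathcomp Require Import lra.
Import Order.TTheory GRing.Theory Num.Theory.
Import numFieldNormedType.Exports.

Set Implicit Arguments.
Unset Strict Implicit.
Unset Printing Implicit Defensive.

Local Open Scope classical_set_scope.
Local Open Scope ring_scope.
Local Open Scope complex_scope.
Local Open Scope cstar_scope.

(** * Real-valued norms and Cauchy sequences *)

(* The norm of a module over [R[i]] is a complex number with zero imaginary
   part; [nr] is the same norm with values in the ordered field [R]. *)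
Definition nr (R : realType) (V : normedModType R[i]) (x : V) : R :=
  complex.Re `|x|.

Lemma Re_normE (R : realType) (a : R[i]) : (complex.Re `|a|)%:C = `|a|.
Proof. by rewrite RRe_real ?normr_real. Qed.

Lemma Re_norm_ge0 (R : realType) (a : R[i]) : 0 <= complex.Re `|a|.
Proof. by rewrite -lecR Re_normE normr_ge0. Qed.

Section RealNorm.
Variables (R : realType) (V : normedModType R[i]).
Implicit Types x y z : V.

Lemma nrE x : (nr x)%:C = `|x|.
Proof. by rewrite /nr RRe_real// normr_real. Qed.

Lemma nr_le x (r : R) : (nr x <= r) = (`|x| <= r%:C).
Proof. by rewrite -nrE lecR. Qed.

Lemma nr_lt x (r : R) : (nr x < r) = (`|x| < r%:C).
Proof. by rewrite -nrE ltcR. Qed.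

Lemma nr_ge0 x : 0 <= nr x.
Proof. by rewrite -lecR nrE normr_ge0. Qed.

Lemma nr0 : nr (0 : V) = 0.
Proof. by rewrite /nr normr0. Qed.

Lemma nr0_eq0 x : nr x = 0 -> x = 0.
Proof. by move=> x0; apply/normr0_eq0; rewrite -nrE x0. Qed.

Lemma nrN x : nr (- x) = nr x.
Proof. by rewrite /nr normrN. Qed.

Lemma nrD x y : nr (x + y) <= nr x + nr y.
Proof. by rewrite -lecR rmorphD/= !nrE ler_normD. Qed.

Lemma nrB x y : nr (x - y) <= nr x + nr y.
Proof. by rewrite -(nrN y) nrD. Qed.

Lemma nr_distC x y : nr (x - y) = nr (y - x).
Proof. by rewrite -nrN opprB. Qed.

Lemma nr_dist_add z x y : nr (x - y) <= nr (x - z) + nr (z - y).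
Proof. by rewrite -[x - y](subrKA z) nrD. Qed.

Lemma nrZ (a : R[i]) x : nr (a *: x) = complex.Re `|a| * nr x.
Proof. by apply: complexI; rewrite rmorphM/= !nrE normrZ. Qed.

Lemma nr_double x : nr (x + x) = 2 * nr x.
Proof.
by rewrite -mulr2n -scaler_nat nrZ normr_nat -(rmorph_nat (real_complex R)).
Qed.

Lemma nrZr (a : R) x : 0 <= a -> nr (a%:C *: x) = a * nr x.
Proof. by move=> a0; rewrite nrZ ger0_norm// ler0c. Qed.

Lemma nr_eps x : (forall e : R, 0 < e -> nr x <= e) -> x = 0.
Proof.
move=> h; apply: nr0_eq0; apply/eqP; rewrite eq_le nr_ge0 andbT.
by apply/ler_addgt0Pl => e e0; rewrite addr0; exact: h.
Qed.

End RealNorm.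

Section CauchySequence.
Variables (R : realType) (V : completeNormedModType R[i]).

Lemma cauchy_seq_lim (u : nat -> V) :
  (forall e : R, 0 < e -> exists N : nat, forall m n : nat,
     (N <= m)%N -> (N <= n)%N -> nr (u m - u n) <= e) ->
  exists l, forall e : R, 0 < e -> exists N : nat, forall n : nat,
     (N <= n)%N -> nr (u n - l) <= e.
Proof.
move=> uC.
have : cvg (u @ \oo).
  apply/cauchy_cvgP/cauchy_exP => e e0.
  have eE : e = (complex.Re e)%:C by rewrite RRe_real// gtr0_real.
  have e2 : 0 < complex.Re e / 2 by rewrite divr_gt0// -ltcR -eE.
  have [N NP] := uC _ e2; exists (u N).
  exists N => // n /= Nn.
  rewrite -ball_normE /= eE -nr_lt (le_lt_trans (NP _ _ _ Nn))//.
  have e0' : 0 < complex.Re e by rewrite -ltcR -eE.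
  lra.
move=> /cvg_ex[l ul]; exists l => e e0.
have /cvgrPdist_le/(_ e%:C) := ul; rewrite ltcR => /(_ e0)[N _ NP].
by exists N => n Nn; rewrite nr_distC nr_le; exact: NP.
Qed.

End CauchySequence.

(** * Norm estimates in C*-algebras *)

Section CStarAlgebraTheory.
Variables (R : realType) (A : cstarAlgType R).
Implicit Types p q r s u v w x y z : A.

Lemma cmulDl x y z : (x + y) ** z = x ** z + y ** z.
Proof. by have := cmul_linearl 1 x y z; rewrite !scale1r. Qed.

Lemma cmulDr x y z : x ** (y + z) = x ** y + x ** z.
Proof. by have := cmul_linearr 1 y z x; rewrite !scale1r. Qed.

Lemma cmul0l x : 0 ** x = 0.
Proof. by apply: (addrI (0 ** x)); rewrite -cmulDl !addr0. Qed.

Lemma cmul0r x : x ** 0 = 0.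
Proof. by apply: (addrI (x ** 0)); rewrite -cmulDr !addr0. Qed.

Lemma cmulZl (a : R[i]) x y : (a *: x) ** y = a *: (x ** y).
Proof. by have := cmul_linearl a x 0 y; rewrite cmul0l !addr0. Qed.

Lemma cmulZr (a : R[i]) x y : x ** (a *: y) = a *: (x ** y).
Proof. by have := cmul_linearr a y 0 x; rewrite cmul0r !addr0. Qed.

Lemma cmulNl x y : (- x) ** y = - (x ** y).
Proof. by rewrite -scaleN1r cmulZl scaleN1r. Qed.

Lemma cmulNr x y : x ** (- y) = - (x ** y).
Proof. by rewrite -scaleN1r cmulZr scaleN1r. Qed.

Lemma starD x y : star (x + y) = star x + star y.
Proof. by have := star_conj_linear 1 x y; rewrite rmorph1 !scale1r. Qed.

Lemma star0 : star (0 : A) = 0.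
Proof. by apply: (addrI (star (0 : A))); rewrite -starD !addr0. Qed.

Lemma starZ (a : R[i]) x : star (a *: x) = a^* *: star x.
Proof. by have := star_conj_linear a x 0; rewrite star0 !addr0. Qed.

Lemma starN x : star (- x) = - star x.
Proof. by rewrite -scaleN1r starZ rmorphN rmorph1 scaleN1r. Qed.

Lemma nr_cmul x y : nr (x ** y) <= nr x * nr y.
Proof. by rewrite -lecR rmorphM/= !nrE; exact: cmul_norm_le. Qed.

Lemma nr_cstar x : nr (star x ** x) = nr x ^+ 2.
Proof.
by apply: complexI; rewrite rmorphXn/= !nrE; exact: cstar_identity.
Qed.

(** The C*-identity bounds [nr y ^+ 2] by [nr (star y) * nr y]. Cancelling [nr y], and using the
    same bound at [star y], gives both inequalities. *)
Lemma nr_star x : nr (star x) = nr x.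
Proof.
suff le y : nr y <= nr (star y).
  by apply/eqP; rewrite eq_le le andbT -{2}(starK x) le.
have [/eqP->|y0] := boolP (nr y == 0); first exact: nr_ge0.
rewrite -(ler_pM2r (_ : 0 < nr y)) ?lt0r ?y0 ?nr_ge0//.
by rewrite -expr2 -nr_cstar nr_cmul.
Qed.

Lemma nr_sqr_sa x : star x = x -> nr (x ** x) = nr x ^+ 2.
Proof. by move=> xE; rewrite -{1}xE nr_cstar. Qed.

(* With [w = u + i v] one has [star w ** w = u ** u + v ** v], and [u] is the
   real part of [w]. *)
Lemma nr_le_sum_sqr u v : star u = u -> star v = v -> u ** v = v ** u ->
  nr u ^+ 2 <= nr (u ** u + v ** v).
Proof.
move=> uE vE uv; pose w := u + 'i *: v.
have wE : star w = u - 'i *: v.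
  by rewrite starD starZ uE vE -scaleNr conjCi.
have -> : u ** u + v ** v = star w ** w.
  rewrite wE cmulDl !cmulDr cmulNl !cmulNl !cmulZl !cmulZr scalerA.
  rewrite -expr2 sqrCi scaleN1r opprK uv addrA addrK//.
rewrite nr_cstar lerXn2r ?nnegrE ?nr_ge0//.
have u2 : u + u = w + star w by rewrite wE /w addrACA subrr addr0.
have : nr (u + u) <= nr w + nr w.
  by rewrite u2 (le_trans (nrD _ _))// nr_star.
rewrite nr_double; lra.
Qed.

(* In a unitization, [(r (1 + s^2))^2 = (r (1 - s^2))^2 + (2 r s)^2]. *)
Lemma nr_mul_1Dsqr r s : star r = r -> star s = s -> s ** r = r ** s ->
  2 * nr (r ** s) <= nr (r + r ** s ** s).
Proof.
move=> rE sE sr.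
have sr' x : x ** s ** r = x ** r ** s by rewrite -!cmulA sr.
have rsE : star (r ** s) = r ** s by rewrite star_cmul rE sE sr.
have rssE : star (r ** s ** s) = r ** s ** s.
  by rewrite star_cmul rsE sE cmulA sr.
(* These are [2 r s] and [r (1 - s^2)]; the factor [r] keeps the expressions inside [A], which may
   lack a unit. *)
pose u := r ** s + r ** s; pose v := r - r ** s ** s.
have uE : star u = u by rewrite starD rsE.
have vE : star v = v by rewrite starD starN rE rssE.
have uv : u ** v = v ** u.
  rewrite /u /v !(cmulDl, cmulDr, cmulNl, cmulNr) !cmulA.
  by rewrite !(sr', sr) [RHS]addrACA.
have := nr_le_sum_sqr uE vE uv.
have -> : u ** u + v ** v = (r + r ** s ** s) ** (r + r ** s ** s).
  rewrite /u /v !(cmulDl, cmulDr, cmulNl, cmulNr) !cmulA !(sr', sr).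
  set X := r ** r; set Y := r ** r ** s ** s; set Z := Y ** s ** s.
  rewrite opprK [- Y + Z]addrC [X - Y + _]addrACA -opprD addrACA subrr addr0.
  by rewrite addrACA [Y + X]addrC.
rewrite nr_sqr_sa; last by rewrite starD rE rssE.
by rewrite nr_double ler_pXn2r // nnegrE ?mulr_ge0 ?nr_ge0.
Qed.

Lemma nr_cmul3_le x y z (a b c : R) :
  nr x <= a -> nr y <= b -> nr z <= c -> nr (x ** y ** z) <= a * b * c.
Proof.
move=> xa yb zc; rewrite (le_trans (nr_cmul _ _))// ler_pM ?nr_ge0//.
by rewrite (le_trans (nr_cmul _ _))// ler_pM ?nr_ge0.
Qed.

(** * Dyadic powers and partial sums of [p / (1 - p^2)] *)

(* [dpow p j] is [p ^ (2 ^ j)], and [dsum p j] is the sum of the [p ^ (2 k + 1)]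
   for [k < 2 ^ j]. *)
Fixpoint dpow p j : A := if j is i.+1 then dpow p i ** dpow p i else p.

Fixpoint dsum p j : A :=
  if j is i.+1 then dsum p i + dsum p i ** dpow p i.+1 else p.

(** Two elements [p] and [q] are allowed in order to cover both commutation, with [q = p], and the
    passage of [a] between [q = a ** star a] and [p = star a ** a]. *)
Lemma dpow_intertwine p q x j :
  q ** x = x ** p -> dpow q j ** x = x ** dpow p j.
Proof.
by move=> qx; elim: j => //= j IH; rewrite -cmulA IH cmulA IH cmulA.
Qed.

Lemma dsum_intertwine p q x j :
  q ** x = x ** p -> dsum q j ** x = x ** dsum p j.
Proof.
move=> qx; elim: j => // j IH; rewrite [dsum q _]/= [dsum p _]/=.
rewrite cmulDl cmulDr -[_ ** _ ** x]cmulA -!/(dpow _ j.+1).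
by rewrite (dpow_intertwine j.+1 qx) !cmulA IH.
Qed.

Lemma dpow_comm p x j : p ** x = x ** p -> dpow p j ** x = x ** dpow p j.
Proof. exact: dpow_intertwine. Qed.

Lemma dsum_comm p x j : p ** x = x ** p -> dsum p j ** x = x ** dsum p j.
Proof. exact: dsum_intertwine. Qed.

Lemma dsum_dpow_comm p i j : dsum p i ** dpow p j = dpow p j ** dsum p i.
Proof. by apply: dsum_comm; rewrite dpow_comm. Qed.

Lemma star_dpow p j : star p = p -> star (dpow p j) = dpow p j.
Proof. by move=> pE; elim: j => //= j IH; rewrite star_cmul IH. Qed.

Lemma star_dsum p j : star p = p -> star (dsum p j) = dsum p j.
Proof.
move=> pE; elim: j => // j IH; rewrite [dsum p _]/= -/(dpow p j.+1).
by rewrite starD star_cmul IH star_dpow// dsum_dpow_comm.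
Qed.

(** Multiplying the odd-power sum by [1 - p^2] leaves only the first term [p] and the tail
    [p ^ (2 ^ (j + 1) + 1)]. *)
Lemma dsum_telescope p j :
  dsum p j - p ** p ** dsum p j = p - p ** dpow p j.+1.
Proof.
elim: j => [|j IH]; first by rewrite /= cmulA.
rewrite [dsum p _]/= -!/(dpow p j.+1).
rewrite cmulDr opprD addrACA [p ** p ** (_ ** _)]cmulA
  -[- (_ ** _ ** dpow p j.+1)]cmulNl -cmulDl IH.
by rewrite cmulDl cmulNl addrA subrK /= !cmulA.
Qed.

Section UnitSelfadjoint.
Variables (p : A) (pE : star p = p) (p1 : nr p = 1).

Lemma nr_dpow j : nr (dpow p j) = 1.
Proof.
by elim: j => //= j IH; rewrite nr_sqr_sa ?star_dpow// IH expr1n.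
Qed.

Lemma nr_dsum_le j : nr (dsum p j) <= 2 ^+ j.
Proof.
elim: j => [|j IH]; first by rewrite /= p1.
rewrite [dsum p _]/= -/(dpow p j.+1) (le_trans (nrD _ _))//.
have := nr_cmul (dsum p j) (dpow p j.+1).
rewrite nr_dpow mulr1 exprS; lra.
Qed.

Lemma nr_dsum_telescope j : nr (dsum p j - p ** p ** dsum p j) <= 2.
Proof.
rewrite dsum_telescope (le_trans (nrB _ _))// p1.
have := nr_cmul p (dpow p j.+1); rewrite p1 nr_dpow; lra.
Qed.

Lemma nr_dpow_cmul j z : nr (dpow p j ** z) <= nr (p ** z).
Proof.
elim: j => //= j IH; rewrite -cmulA (le_trans (nr_cmul _ _))//.
by rewrite nr_dpow mul1r.
Qed.

(** A norm version of the arithmetic-geometric mean inequality: the [2 ^ j] odd exponents in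
    [dsum p j] have mean [2 ^ j]. With [c = dsum p j] and [h = dpow p j], the next sum is
    [c (1 + h^2)]; [nr_mul_1Dsqr] extracts [2 h], and the induction hypothesis is used at
    [r ** h]. *)
Lemma nr_cmul_dsum_ge r j : star r = r -> r ** p = p ** r ->
  2 ^+ j * nr (r ** dpow p j) <= nr (r ** dsum p j).
Proof.
elim: j r => [|j IH] r rE rp; first by rewrite expr0 mul1r.
have rh : r ** dpow p j = dpow p j ** r by rewrite dpow_comm.
have rc : r ** dsum p j = dsum p j ** r by rewrite dsum_comm.
have hE := star_dpow j pE; have cE := star_dsum j pE.
have ch := dsum_dpow_comm p j j.
have rcE : star (r ** dsum p j) = r ** dsum p j.
  by rewrite star_cmul rE cE rc.
have := @nr_mul_1Dsqr (r ** dsum p j) (dpow p j) rcE hE.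
rewrite cmulA -rh -cmulA -ch cmulA => /(_ erefl).
have rhE : star (r ** dpow p j) = r ** dpow p j.
  by rewrite star_cmul rE hE rh.
have := IH (r ** dpow p j) rhE.
rewrite -!cmulA dpow_comm// !cmulA rp => /(_ erefl).
rewrite [dsum p _]/= [dpow p _]/= cmulDr !cmulA.
rewrite -[r ** dpow p j ** dsum p j]cmulA -ch cmulA exprS; lra.
Qed.

(** With [h = dpow p j], first [nr_dpow_cmul] replaces the factor [p] by [h]. Then
    [nr_cmul_dsum_ge], used at [h ** dsum p j] and at [h ** h], trades each sum for [2 ^ j] times
    [h]. The remaining [h^3] has norm at least 1 because [h^4] is [dpow p j.+2]. *)
Lemma nr_cmul_dsum2_ge j : 4 ^+ j <= nr (p ** dsum p j ** dsum p j).
Proof.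
have hE := star_dpow j pE; have cE := star_dsum j pE.
have ch := dsum_dpow_comm p j j.
have hp : dpow p j ** p = p ** dpow p j by rewrite dpow_comm.
have cp : dsum p j ** p = p ** dsum p j by rewrite dsum_comm.
have hcE : star (dpow p j ** dsum p j) = dpow p j ** dsum p j.
  by rewrite star_cmul hE cE.
have hhE : star (dpow p j ** dpow p j) = dpow p j ** dpow p j.
  by rewrite star_cmul hE.
have hcp : dpow p j ** dsum p j ** p = p ** (dpow p j ** dsum p j).
  by rewrite -cmulA cp !cmulA hp.
have hhp : dpow p j ** dpow p j ** p = p ** (dpow p j ** dpow p j).
  by rewrite -cmulA hp !cmulA hp.
have h1 := nr_cmul_dsum_ge j hcE hcp.
have h2 := nr_cmul_dsum_ge j hhE hhp.
have h3 := nr_dpow_cmul j (dsum p j ** dsum p j).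
have h4 : 1 <= nr (dpow p j ** dpow p j ** dpow p j).
  rewrite -(nr_dpow j.+2) /= cmulA (le_trans (nr_cmul _ _))//.
  by rewrite nr_dpow mulr1.
rewrite -cmulA (le_trans _ h3)// cmulA (le_trans _ h1)//.
rewrite -cmulA ch cmulA (le_trans _ (ler_wpM2l _ h2))//.
have -> : (4 : R) = 2 * 2 by lra.
by rewrite exprMn mulrA ler_peMr// mulr_ge0.
Qed.

End UnitSelfadjoint.

End CStarAlgebraTheory.

(** * Contractivity of triple homomorphisms *)

Lemma neumann_fixpoint (R : realType) (V : completeNormedModType R[i])
    (D : V -> V) (k : R) (x : V) :
  {morph D : y z / y - z} -> 0 <= k < 1 ->
  (forall z, nr (D z) <= k * nr z) -> exists y, y = x + D y.
Proof.
move=> DB /andP[k0 k1] Dk.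
pose u n := iter n (fun y => x + D y) 0.
(* [K] solves [K = nr x + k * K], so it bounds every partial sum of the Neumann series. *)
pose K := nr x / (1 - k).
have k1' : 0 < 1 - k by rewrite subr_gt0.
have K0 : 0 <= K by rewrite divr_ge0// ?nr_ge0// ltW.
have KE : nr x + k * K = K.
  have : K * (1 - k) = nr x by rewrite /K divfK// gt_eqF.
  lra.
have uK m n : nr (u (n + m)%N - u n) <= k ^+ n * K.
  elim: n => [|n IH].
    rewrite add0n subr0 expr0 mul1r; elim: m => [|m IH]; first by rewrite nr0.
    rewrite /u iterS -/(u m) (le_trans (nrD _ _))// -KE lerD2l.
    by rewrite (le_trans (Dk _))// ler_wpM2l.
  rewrite addSn /u !iterS -!/(u _) opprD addrACA subrr add0r -DB.
  by rewrite (le_trans (Dk _))// exprS -mulrA ler_wpM2l.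
have small (e : R) : 0 < e -> exists N : nat, k ^+ N * K <= e.
  (* [K] vanishes when [x = 0]; dividing by [K + 1] avoids that case. *)
  move=> e0; have eK : 0 < e / (K + 1).
    by rewrite divr_gt0// ltr_wpDl.
  have /cvgr0Pnorm_le/(_ _ eK)[N _ /(_ N (leqnn N))/=] :
      k ^+ n @[n --> \oo] --> 0.
    by apply: cvg_expr; rewrite ger0_norm.
  rewrite ger0_norm ?exprn_ge0// ler_pdivlMr ?ltr_wpDl// => kN.
  by exists N; rewrite (le_trans _ kN)// ler_wpM2l ?exprn_ge0// lerDl.
have uN N n : (N <= n)%N -> nr (u n - u N) <= k ^+ N * K.
  by move=> Nn; rewrite -(subnKC Nn).
have [e e0|l ul] := @cauchy_seq_lim R V u.
  have e2 : 0 < e / 2 by lra.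
  have [N NP] := small _ e2; exists N => m n Nm Nn.
  rewrite (le_trans (nr_dist_add (u N) _ _))//.
  have := uN _ _ Nm; have := uN _ _ Nn; rewrite [nr (u N - _)]nr_distC; lra.
exists l; apply/eqP; rewrite -subr_eq0; apply/eqP/nr_eps => e e0.
have e2 : 0 < e / 2 by lra.
have [N NP] := ul _ e2.
rewrite (le_trans (nr_dist_add (u N.+1) _ _))//.
have h1 : nr (l - u N.+1) <= e / 2 by rewrite nr_distC; exact: NP.
have h2 : nr (u N.+1 - (x + D l)) <= e / 2.
  rewrite /u iterS -/(u N) opprD addrACA subrr add0r -DB (le_trans (Dk _))//.
  rewrite (le_trans _ (NP _ (leqnn N)))// ler_piMl ?nr_ge0// ltW//.
lra.
Qed.

Section TripleHomContractive.
Variables (R : realType) (V : completeNormedModType R[i]).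
(** An abstract [tp] lets the result serve both [jctriple] and [cstar_triple], the latter for
    *-homomorphisms. *)
Variables (tp : V -> V -> V -> V) (A : cstarAlgType R) (f : V -> A).
Hypothesis tp_norm : forall a b c, nr (tp a b c) <= nr a * nr b * nr c.
Hypothesis tpB : forall a b, {morph tp a b : c d / c - d}.
Hypothesis f_linear : linear f.
Hypothesis f_tp : forall a b c, f (tp a b c) = cstar_triple (f a) (f b) (f c).

(* If [nr x < 1 = nr (f x)], the Neumann series gives [y] with
   [y = x + {x, {x,x,x}, y}], "x / (1 - (x^* x)^2)".  Multiplying the image of
   this equation by the partial sums [dsum] of [1 / (1 - p^2)], where
   [p = (f x)^* (f x)] has norm [1], produces a left-hand side of order [2 ^ j]
   and a right-hand side of order [4 ^ j]. *)
Lemma triple_hom_unit_le x : nr (f x) = 1 -> 1 <= nr x.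
Proof.
move=> a1; rewrite leNgt; apply/negP => x1.
pose t := tp x x x.
have x0 := nr_ge0 x; have x1' := ltW x1.
have t1 : nr t <= 1.
  by rewrite (le_trans (tp_norm _ _ _))// !mulr_ile1 ?mulr_ge0.
have [|z|y yE] := @neumann_fixpoint R V (tp x t) (nr x * nr t) x (@tpB x t).
- by rewrite mulr_ge0 ?nr_ge0//= (le_lt_trans _ x1)// ler_piMr.
- exact: tp_norm.
set a := f x in a1; set b := f y.
pose p := star a ** a; pose q := a ** star a.
have pE : star p = p by rewrite /p star_cmul starK.
have qE : star q = q by rewrite /q star_cmul starK.
have p1 : nr p = 1 by rewrite nr_cstar a1 expr1n.
have q1 : nr q = 1 by rewrite /q -{1}(starK a) nr_cstar nr_star a1 expr1n.
have qa : q ** a = a ** p by rewrite /q /p cmulA.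
have halfD (z : A) : 2^-1 *: (z + z) = z.
  by rewrite -mulr2n -[z *+ 2]scaler_nat scalerA mulVf ?scale1r// pnatr_eq0.
have ftE : f t = q ** a by rewrite f_tp /cstar_triple halfD.
have fD u v : f (u + v) = f u + f v.
  by have := f_linear 1 u v; rewrite !scale1r.
(* As [f t = q ** a], the image of the equation for [y] is [b = a + (q^2 b + b p^2) / 2], doubled
   here to clear the fraction. *)
have bE : b + b = a + a + (q ** q ** b + b ** p ** p).
  have : b = a + 2^-1 *: (q ** q ** b + b ** p ** p).
    rewrite {1}/b yE fD f_tp ftE /cstar_triple star_cmul qE -/a -/b.
    by congr (_ + _ *: (_ + _)); rewrite /q /p !cmulA.
  move=> h; rewrite {1 2}h addrACA -scalerDr halfD//.
have key j : 4 ^+ j * 2 <= 2 ^+ j * nr b * 4.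
  set c := dsum p j; set d := dsum q j.
  have da : d ** a = a ** c by exact: dsum_intertwine.
  (* This is [bE] multiplied by [d] on the left and [c] on the right. On the left-hand side the
     telescoped factors have norm at most 2, while [c] and [d] have norm at most [2 ^ j]. *)
  have E : (d - q ** q ** d) ** b ** c + d ** b ** (c - p ** p ** c) =
           a ** c ** c + a ** c ** c.
    have dq : q ** q ** d = d ** q ** q.
      by rewrite -cmulA -(dsum_comm j (erefl (q ** q))) cmulA -dsum_comm.
    have := congr1 (fun z => d ** z ** c) bE.
    rewrite !(cmulDl, cmulDr, cmulNl, cmulNr) da dq !cmulA => E.
    rewrite addrACA E -opprD addrK//.
  have : nr (a ** c ** c + a ** c ** c) <= 2 ^+ j * nr b * 4.
    rewrite -E (le_trans (nrD _ _))//.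
    have c2 : nr c <= 2 ^+ j by exact: nr_dsum_le.
    have d2 : nr d <= 2 ^+ j by exact: nr_dsum_le.
    have c3 : nr (c - p ** p ** c) <= 2 by exact: nr_dsum_telescope.
    have d3 : nr (d - q ** q ** d) <= 2 by exact: nr_dsum_telescope.
    have := nr_cmul3_le d3 (lexx (nr b)) c2.
    have := nr_cmul3_le d2 (lexx (nr b)) c3.
    lra.
  (* Since [p ** c ** c] is [star a ** (a ** c ** c)] and [nr (star a) = 1], the lower bound for the
     former also holds for [a ** c ** c]. *)
  rewrite nr_double; apply: le_trans; rewrite mulrC ler_pM2l//.
  rewrite (le_trans (nr_cmul_dsum2_ge pE p1 j))// -/c /p -!cmulA.
  by rewrite (le_trans (nr_cmul _ _))// nr_star a1 mul1r.
have key' j : 2 ^+ j <= 2 * nr b.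
  have j0 : (0 : R) < 2 ^+ j by rewrite exprn_gt0.
  rewrite -(ler_pM2l j0); have := key j.
  have -> : (4 : R) = 2 * 2 by lra.
  rewrite exprMn; lra.
have := key' (Num.bound (2 * nr b)); apply/negP; rewrite -ltNge.
rewrite (lt_trans (archi_boundP _)) ?mulr_ge0 ?nr_ge0//.
by rewrite -natrX ltr_nat ltn_expl.
Qed.

Lemma triple_hom_contractive x : nr (f x) <= nr x.
Proof.
have [->|fx0] := eqVneq (f x) 0; first by rewrite nr0 nr_ge0.
have n0 : 0 < nr (f x).
  by rewrite lt0r nr_ge0 andbT; apply: contra_neq fx0; exact: nr0_eq0.
have fZ (k : R[i]) : f (k *: x) = k *: f x.
  have f0 : f 0 = 0.
    by have := f_linear (-1) 0 0; rewrite !scaleN1r oppr0 addr0 addNr.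
  by have := f_linear k x 0; rewrite f0 !addr0.
have := @triple_hom_unit_le ((nr (f x))^-1%:C *: x).
rewrite fZ !nrZr ?invr_ge0 ?nr_ge0// mulVf ?gt_eqF// => /(_ erefl).
by rewrite mulrC ler_pdivlMr// mul1r.
Qed.

End TripleHomContractive.

(** * The algebra generated by a family of maps *)

(** Formal *-polynomials without constant term. They are pure syntax, independent of any C*-algebra,
    so that seminorms on them can index a product. *)
Inductive sterm (R : realType) (X : Type) : Type :=
| TVar of X
| TZero
| TLin of R[i] & sterm R X & sterm R X
| TMul of sterm R X & sterm R X
| TStar of sterm R X.
Arguments TZero {R X}.
Arguments TVar R {X}.

Fixpoint teval (R : realType) (X : Type) (A : cstarAlgType R) (f : X -> A)
    (t : sterm R X) : A :=
  match t with
  | TVar x => f x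
  | TZero => 0
  | TLin a t u => a *: teval f t + teval f u
  | TMul t u => teval f t ** teval f u
  | TStar t => star (teval f t)
  end.

Section GeneratedAlgebra.
Variables (R : realType) (I : Type) (A : I -> cstarAlgType R).
Variables (X : Type) (pi : forall i, X -> A i).
Implicit Types f g : forall i, A i.

Definition bounded_fam f := exists M : R, forall i, nr (f i) <= M.

(** The term is chosen before the index, so the approximation is uniform: this is closure in the
    supremum norm. *)
Definition term_closure f := bounded_fam f /\
  forall e : R, 0 < e -> exists t : sterm R X,
    forall i, nr (f i - teval (@pi i) t) <= e.

Lemma bounded_famP f : bounded_fam f ->
  exists2 M : R, 0 < M & forall i, nr (f i) <= M.
Proof.
move=> [M fM]; exists (`|M| + 1); first by rewrite ltr_wpDl.
by move=> i; rewrite (le_trans (fM i))// (le_trans (ler_norm M))// lerDl.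
Qed.

Lemma term_closure0 : term_closure (fun i => 0 : A i).
Proof.
split; first by exists 0 => i; rewrite nr0.
by move=> e e0; exists TZero => i; rewrite subrr nr0 ltW.
Qed.

Lemma term_closure_lin (a : R[i]) f g : term_closure f -> term_closure g ->
  term_closure (fun i => a *: f i + g i).
Proof.
move=> [[M fM] ft] [[N gN] gt]; set k := complex.Re `|a|.
have k0 : 0 <= k by exact: Re_norm_ge0.
split.
  exists (k * M + N) => i.
  by rewrite (le_trans (nrD _ _))// nrZ lerD// ler_wpM2l.
(* The tolerance for [f] is divided by [k + 1], which is positive even when [a = 0]. *)
move=> e e0; have k1 : 0 < k + 1 by rewrite ltr_wpDl.
have e2 : 0 < e / 2 by lra.
have [t tP] := ft _ (divr_gt0 e2 k1); have [u uP] := gt _ e2.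
exists (TLin a t u) => i /=.
rewrite opprD addrACA -scalerBr (le_trans (nrD _ _))// nrZ.
have := tP i; rewrite ler_pdivlMr// => ti; have ui := uP i.
have := nr_ge0 (f i - teval (@pi i) t).
rewrite -/k; nra.
Qed.

Lemma term_closure_mul f g : term_closure f -> term_closure g ->
  term_closure (fun i => f i ** g i).
Proof.
move=> [/bounded_famP[M M0 fM] ft] [/bounded_famP[N N0 gN] gt]; split.
  exists (M * N) => i.
  by rewrite (le_trans (nr_cmul _ _))// ler_pM ?nr_ge0.
move=> e e0.
have e2 : 0 < e / 2 by lra.
have N2 := divr_gt0 e2 N0; have [t tP] := ft _ N2.
(* [K] bounds the approximant of [f], so the tolerance for [g] is fixed only after that for [f]. *)
pose K := M + e / 2 / N.
have K0 : 0 < K by rewrite addr_gt0.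
have [u uP] := gt _ (divr_gt0 e2 K0).
exists (TMul t u) => i /=; set p := teval _ t; set q := teval _ u.
have -> : f i ** g i - p ** q = (f i - p) ** g i + p ** (g i - q).
  by rewrite cmulDl cmulNl cmulDr cmulNr addrA subrK.
have pK : nr p <= K.
  rewrite -[p](subrK (f i)) addrC (le_trans (nrD _ _))// lerD// nr_distC.
  exact: tP.
have h1 : nr ((f i - p) ** g i) <= e / 2.
  rewrite (le_trans (nr_cmul _ _))//.
  by rewrite -[leRHS](divfK (lt0r_neq0 N0)) ler_pM ?nr_ge0.
have h2 : nr (p ** (g i - q)) <= e / 2.
  rewrite (le_trans (nr_cmul _ _))// mulrC.
  by rewrite -[leRHS](divfK (lt0r_neq0 K0)) ler_pM ?nr_ge0.
rewrite (le_trans (nrD _ _))//; lra.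
Qed.

Lemma term_closure_star f : term_closure f ->
  term_closure (fun i => star (f i)).
Proof.
move=> [[M fM] ft]; split; first by exists M => i; rewrite nr_star.
move=> e /ft[t tP]; exists (TStar t) => i /=.
by rewrite -starN -starD nr_star.
Qed.

Lemma term_closure_lim f : 
  (forall e : R, 0 < e -> exists2 g, term_closure g &
     forall i, nr (f i - g i) <= e) -> term_closure f.
Proof.
move=> fl; split.
  have [g [[M gM] _] fg] := fl 1 ltr01.
  exists (1 + M) => i; rewrite -[f i](subrK (g i)) (le_trans (nrD _ _))//.
  exact: lerD.
move=> e e0; have e2 : 0 < e / 2 by lra.
have [g [_ /(_ _ e2)[t tP]] fg] := fl _ e2.
exists t => i; rewrite (le_trans (nr_dist_add (g i) _ _))//.
have := tP i; have := fg i; lra.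
Qed.

Lemma eq_term_closure f g : (forall i, f i = g i) ->
  term_closure f -> term_closure g.
Proof. by move=> fg; rewrite (functional_extensionality_dep fg). Qed.

Lemma term_closure_add f g : term_closure f -> term_closure g ->
  term_closure (fun i => f i + g i).
Proof.
move=> fP gP; apply: eq_term_closure (term_closure_lin 1 fP gP) => i.
by rewrite scale1r.
Qed.

Lemma term_closure_scale (a : R[i]) f : term_closure f ->
  term_closure (fun i => a *: f i).
Proof.
move=> fP; apply: eq_term_closure (term_closure_lin a fP term_closure0) => i.
by rewrite addr0.
Qed.

Lemma term_closure_opp f : term_closure f -> term_closure (fun i => - f i).
Proof.
move=> fP; apply: eq_term_closure (term_closure_scale (-1) fP) => i.
by rewrite scaleN1r.
Qed.

(* The closed *-subalgebra of the l^oo-product of the [A i] generated by the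
   diagonal elements [fun i => pi i x]. *)
Record gen_alg := GenAlg { ga_fun :> forall i, A i; _ : term_closure ga_fun }.

Lemma ga_closure (f : gen_alg) : term_closure f. Proof. by case: f. Qed.

Lemma ga_eq (f g : gen_alg) : (forall i, f i = g i) -> f = g.
Proof.
case: f g => [f fP] [g gP] /= fg.
have {}fg : f = g by exact: functional_extensionality_dep.
by case: _ / fg gP => gP; congr GenAlg; exact: Prop_irrelevance.
Qed.

HB.instance Definition _ := gen_eqMixin gen_alg.
HB.instance Definition _ := gen_choiceMixin gen_alg.

Implicit Types x y z : gen_alg.

Definition ga_zero := GenAlg term_closure0.
Definition ga_add x y :=
  GenAlg (term_closure_add (ga_closure x) (ga_closure y)).
Definition ga_opp x := GenAlg (term_closure_opp (ga_closure x)).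
Definition ga_scale a x := GenAlg (term_closure_scale a (ga_closure x)).
Definition ga_mul x y :=
  GenAlg (term_closure_mul (ga_closure x) (ga_closure y)).
Definition ga_star x := GenAlg (term_closure_star (ga_closure x)).

Lemma ga_addA : associative ga_add.
Proof. by move=> x y z; apply: ga_eq => i; exact: addrA. Qed.
Lemma ga_addC : commutative ga_add.
Proof. by move=> x y; apply: ga_eq => i; exact: addrC. Qed.
Lemma ga_add0 : left_id ga_zero ga_add.
Proof. by move=> x; apply: ga_eq => i; exact: add0r. Qed.
Lemma ga_addN : left_inverse ga_zero ga_opp ga_add.
Proof. by move=> x; apply: ga_eq => i; exact: addNr. Qed.

HB.instance Definition _ :=
  GRing.isZmodule.Build gen_alg ga_addA ga_addC ga_add0 ga_addN.

Lemma ga_scaleA a b x : ga_scale a (ga_scale b x) = ga_scale (a * b) x.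
Proof. by apply: ga_eq => i; exact: scalerA. Qed.
Lemma ga_scale1 : left_id 1 ga_scale.
Proof. by move=> x; apply: ga_eq => i; exact: scale1r. Qed.
Lemma ga_scaleDr : right_distributive ga_scale +%R.
Proof. by move=> a x y; apply: ga_eq => i; exact: scalerDr. Qed.
Lemma ga_scaleDl x : {morph ga_scale^~ x : a b / a + b}.
Proof. by move=> a b; apply: ga_eq => i; exact: scalerDl. Qed.

HB.instance Definition _ := GRing.Zmodule_isLmodule.Build R[i] gen_alg
  ga_scaleA ga_scale1 ga_scaleDr ga_scaleDl.

(* [0] is adjoined so that the supremum is also meaningful for empty [I]. *)
Definition ga_norm x : R := sup [set r : R | r = 0 \/ exists i, r = nr (x i)].

Lemma ga_norm_has_sup x :
  has_sup [set r : R | r = 0 \/ exists i, r = nr (x i)].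
Proof.
split; first by exists 0; left.
have [M M0 xM] := bounded_famP (ga_closure x).1.
by exists M => r /= [->|[i ->]]; rewrite // ltW.
Qed.

Lemma nr_ga_norm x i : nr (x i) <= ga_norm x.
Proof. by apply: sup_upper_bound; [exact: ga_norm_has_sup|right; exists i]. Qed.

Lemma ga_norm_ge0 x : 0 <= ga_norm x.
Proof. by apply: sup_upper_bound; [exact: ga_norm_has_sup|left]. Qed.

Lemma ga_norm_le x (M : R) : 0 <= M -> (forall i, nr (x i) <= M) ->
  ga_norm x <= M.
Proof.
move=> M0 xM; apply: ge_sup; first by exists 0; left.
by move=> r /= [->|[i ->]].
Qed.

Lemma ga_norm_triangle x y :
  (ga_norm (x + y))%:C <= (ga_norm x)%:C + (ga_norm y)%:C.
Proof.
rewrite -rmorphD lecR; apply: ga_norm_le; first by rewrite addr_ge0 ?ga_norm_ge0.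
by move=> i; rewrite (le_trans (nrD _ _))// lerD ?nr_ga_norm.
Qed.

Lemma ga_norm_scale_le (a : R[i]) x :
  ga_norm (a *: x) <= complex.Re `|a| * ga_norm x.
Proof.
have k0 := Re_norm_ge0 a.
apply: ga_norm_le => [|i]; first by rewrite mulr_ge0 ?ga_norm_ge0.
by rewrite nrZ ler_wpM2l ?nr_ga_norm.
Qed.

Lemma ga_norm_scale (a : R[i]) x :
  (ga_norm (a *: x))%:C = `|a| * (ga_norm x)%:C.
Proof.
have kE := Re_normE a.
rewrite -kE -rmorphM; congr _%:C; apply/eqP.
rewrite eq_le ga_norm_scale_le andTb.
have [->|a0] := eqVneq a 0; first by rewrite normr0 mul0r ga_norm_ge0.
have k0 : 0 < complex.Re `|a| by rewrite -ltcR kE normr_gt0.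
have kV : complex.Re `|a^-1| = (complex.Re `|a|)^-1.
  by apply: complexI; rewrite fmorphV !Re_normE normfV.
(* The reverse inequality is the bound already proved, applied to [a^-1] and [a *: x]. *)
have := ga_norm_scale_le a^-1 (a *: x).
by rewrite kV scalerA mulVf// scale1r mulrC ler_pdivlMr// mulrC.
Qed.

Lemma ga_norm_eq0 x : (ga_norm x)%:C = 0 -> x = 0.
Proof.
move=> /complexI x0; apply: ga_eq => i; apply: nr0_eq0.
by apply/eqP; rewrite eq_le nr_ge0 andbT -x0 nr_ga_norm.
Qed.

HB.instance Definition _ := Lmodule_isNormed.Build R[i] gen_alg
  ga_norm_triangle ga_norm_scale ga_norm_eq0.

Lemma ga_norm_bound x (e : R) : 0 <= e ->
  (nr x <= e <-> forall i, nr (x i) <= e).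
Proof.
move=> e0; split; last exact: ga_norm_le.
by move=> xe i; rewrite (le_trans _ xe)// nr_ga_norm.
Qed.

Lemma ball_nr (V : normedModType R[i]) (x y : V) (e : R) :
  ball x e%:C y = (nr (x - y) < e) :> Prop.
Proof. by rewrite nr_lt -ball_normE. Qed.

(** Each coordinate converges by completeness of [A i]. The Cauchy estimates are uniform in [i] and
    pass to the coordinatewise limit, which therefore stays in [term_closure] and is the limit in
    norm. *)
Lemma ga_complete (F : set_system gen_alg) :
  ProperFilter F -> cauchy F -> cvg F.
Proof.
move=> FF /cauchyP FC.
have FC' (e : R) : 0 < e -> exists x, F [set y : gen_alg | nr (x - y) < e].
  rewrite -ltcR => /FC[x xF]; exists x; apply: filterS xF => y.
  by rewrite ball_nr.
have lP i : exists l : A i, forall e : R, 0 < e ->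
    F [set y : gen_alg | nr (l - y i) < e].
  have /cvg_ex[l ul] : cvg ((fun y : gen_alg => y i) @ F).
    apply/cauchy_cvgP/cauchy_exP => e e0.
    have eE : e = (complex.Re e)%:C by rewrite RRe_real// gtr0_real.
    have [|x xF] := FC' (complex.Re e); first by rewrite -ltcR -eE.
    exists (x i); apply: (@filterS _ F _ _ _ _ xF) => y /= xy.
    rewrite eE ball_nr (le_lt_trans _ xy)//.
    exact: (nr_ga_norm (x - y) i).
  exists l => e e0; have e0' : 0 < e%:C by rewrite ltcR.
  have /cvgrPdist_lt/(_ _ e0') := ul.
  by apply: (@filterS _ F) => y; rewrite -nr_lt.
pose l i := projT1 (cid (lP i)).
have lE i (d : R) : 0 < d -> F [set y : gen_alg | nr (l i - y i) < d].
  exact: (projT2 (cid (lP i))).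
move: l lE => {lP} l lP.
have ball_lim x (e : R) : F [set y : gen_alg | nr (x - y) < e] ->
    forall i, nr (l i - x i) <= e.
  move=> xF i; apply/ler_addgt0Pl => d d0.
  have [y [/= xy ly]] := filter_ex (filterI xF (lP i d d0)).
  rewrite (le_trans (nr_dist_add (y i) _ _))// lerD// ltW//.
  rewrite nr_distC (le_lt_trans _ xy)//.
  exact: (nr_ga_norm (x - y) i).
have lC : term_closure l.
  apply: term_closure_lim => e e0; have [x xF] := FC' _ e0.
  by exists x; [exact: ga_closure|exact: ball_lim].
apply/cvg_ex; exists (GenAlg lC).
apply/cvgrPdist_lt => e e0.
have eE : e = (complex.Re e)%:C by rewrite RRe_real// gtr0_real.
have e0' : 0 < complex.Re e by rewrite -ltcR -eE.
have e3 : 0 < complex.Re e / 3 by lra.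
have [x xF] := FC' _ e3; apply: filterS (xF) => y /= xy.
rewrite eE -nr_lt (le_lt_trans (nr_dist_add x _ _))//.
have : nr (GenAlg lC - x) <= complex.Re e / 3.
  by apply/ga_norm_bound; [exact: ltW|exact: ball_lim].
lra.
Qed.

HB.instance Definition _ := Uniform_isComplete.Build gen_alg ga_complete.

Lemma ga_mulA : associative ga_mul.
Proof. by move=> x y z; apply: ga_eq => i; exact: cmulA. Qed.

Lemma ga_mul_linearl (a : R[i]) x y z :
  ga_mul (a *: x + y) z = a *: ga_mul x z + ga_mul y z.
Proof. by apply: ga_eq => i; exact: cmul_linearl. Qed.

Lemma ga_mul_linearr (a : R[i]) x y z :
  ga_mul z (a *: x + y) = a *: ga_mul z x + ga_mul z y.
Proof. by apply: ga_eq => i; exact: cmul_linearr. Qed.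

Lemma ga_star_conj_linear (a : R[i]) x y :
  ga_star (a *: x + y) = a^* *: ga_star x + ga_star y.
Proof. by apply: ga_eq => i; exact: star_conj_linear. Qed.

Lemma ga_starK : involutive ga_star.
Proof. by move=> x; apply: ga_eq => i; exact: starK. Qed.

Lemma ga_star_mul x y : ga_star (ga_mul x y) = ga_mul (ga_star y) (ga_star x).
Proof. by apply: ga_eq => i; exact: star_cmul. Qed.

Lemma ga_mul_norm_le x y : `|ga_mul x y| <= `|x| * `|y|.
Proof.
rewrite -!nrE -rmorphM lecR; apply/ga_norm_bound => [|i].
  by rewrite mulr_ge0 ?nr_ge0.
rewrite (le_trans (nr_cmul _ _))// ler_pM ?nr_ge0//; exact: nr_ga_norm.
Qed.

Lemma ga_cstar_identity x : `|ga_mul (ga_star x) x| = `|x| ^+ 2.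
Proof.
rewrite -!nrE -rmorphXn; congr _%:C.
have star_le y : nr (ga_star y) <= nr y.
  by apply/ga_norm_bound => [|i]; rewrite ?nr_ge0// nr_star; exact: nr_ga_norm.
apply/eqP; rewrite eq_le; apply/andP; split.
  rewrite -lecR nrE (le_trans (ga_mul_norm_le _ _))// -!nrE -rmorphM lecR.
  by rewrite expr2 ler_wpM2r ?nr_ge0.
set n := nr (ga_mul _ _); have n0 : 0 <= n by exact: nr_ge0.
(* Comparing with the square root of [n] reduces the claim to coordinates, where the C*-identity of
   [A i] applies. *)
rewrite -(sqr_sqrtr n0) ler_pXn2r ?nnegrE ?nr_ge0 ?sqrtr_ge0//.
apply/ga_norm_bound => [|i]; first exact: sqrtr_ge0.
rewrite -(ler_pXn2r (ltn0Sn 1)) ?nnegrE ?nr_ge0 ?sqrtr_ge0// sqr_sqrtr//.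
rewrite -nr_cstar; exact: (nr_ga_norm (ga_mul (ga_star x) x) i).
Qed.

HB.instance Definition _ := isCStarAlgebra.Build R gen_alg ga_mulA
  ga_mul_linearl ga_mul_linearr ga_star_conj_linear ga_starK ga_star_mul
  ga_mul_norm_le ga_cstar_identity.

End GeneratedAlgebra.

(** * Closed sets and *-homomorphisms *)

Lemma closed_nrP (R : realType) (V : normedModType R[i]) (S : set V) :
  closed S <-> forall x, (forall e : R, 0 < e -> exists2 y, S y & nr (x - y) <= e) ->
    S x.
Proof.
split=> [Scl x xS|Scl x xS].
  apply: Scl => B /nbhs_ballP[e /= e0 eB].
  have eE : e = (complex.Re e)%:C by rewrite RRe_real// gtr0_real.
  have e0' : 0 < complex.Re e by rewrite -ltcR -eE.
  have [|y Sy xy] := xS (complex.Re e / 2); first lra.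
  exists y; split => //; apply: eB; rewrite eE ball_nr; lra.
apply: Scl => e e0.
have [|y [Sy]] := xS (ball x e%:C).
  by apply/nbhs_ballP; exists e%:C; rewrite //= ltcR.
by rewrite ball_nr => /ltW xy; exists y.
Qed.

Lemma nr_cstar_triple (R : realType) (A : cstarAlgType R) (a b c : A) :
  nr (cstar_triple a b c) <= nr a * nr b * nr c.
Proof.
have h1 := nr_cmul3_le (lexx (nr a)) (lexx (nr (star b))) (lexx (nr c)).
have h2 := nr_cmul3_le (lexx (nr c)) (lexx (nr (star b))) (lexx (nr a)).
have N2 : complex.Re `|2^-1 : R[i]| = 2^-1.
  by apply: complexI; rewrite Re_normE normfV normr_nat fmorphV rmorph_nat.
rewrite /cstar_triple nrZ N2 ler_pdivrMl//.
rewrite nr_star in h1 h2.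
rewrite (le_trans (nrD _ _))//; nra.
Qed.

Lemma cstar_tripleB (R : realType) (A : cstarAlgType R) (a b : A) :
  {morph cstar_triple a b : c d / c - d}.
Proof.
move=> c d; rewrite /cstar_triple cmulDr cmulNr !cmulDl !cmulNl addrACA -opprD.
by rewrite scalerBr.
Qed.

(** A *-homomorphism preserves [cstar_triple], so contractivity follows from the triple case without
    spectral theory. *)
Lemma star_hom_contractive (R : realType) (A B : cstarAlgType R) (g : A -> B) :
  is_star_hom g -> forall x, nr (g x) <= nr x.
Proof.
move=> [gl gM gs]; have gD u v : g (u + v) = g u + g v.
  by have := gl 1 u v; rewrite !scale1r.
have g0 : g 0 = 0 by apply: (addrI (g 0)); rewrite -gD !addr0.
have gZ a u : g (a *: u) = a *: g u by have := gl a u 0; rewrite g0 !addr0.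
apply: (@triple_hom_contractive _ _ (@cstar_triple R A)) => //.
- exact: nr_cstar_triple.
- exact: cstar_tripleB.
- by move=> a b c; rewrite /cstar_triple gZ gD !gM gs.
Qed.

Lemma linear_funB (R : realType) (V W : lmodType R[i]) (f : V -> W) :
  linear f -> {morph f : x y / x - y}.
Proof.
move=> fl x y; have := fl (-1) y x; rewrite !scaleN1r.
by rewrite [- y + x]addrC [- f y + f x]addrC.
Qed.

(** The equalizer of [g] and [h] is a C*-subalgebra; its closedness comes from contractivity. *)
Lemma star_hom_eq_on_generators (R : realType) (A B : cstarAlgType R)
    (G : set A) (g h : A -> B) : cstar_generated G = setT ->
  is_star_hom g -> is_star_hom h -> (forall x, G x -> g x = h x) -> g = h.
Proof.
move=> GT gP hP ghG; apply/funext => x.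
have [gl gM gs] := gP; have [hl hM hs] := hP.
have g0 : g 0 = 0 by rewrite -(subrr 0) (linear_funB gl) subrr.
have h0 : h 0 = 0 by rewrite -(subrr 0) (linear_funB hl) subrr.
have : cstar_generated G x by rewrite GT.
move=> /(_ [set y | g y = h y]); apply; split; last exact: ghG.
split; [split| |] => /=.
- by rewrite g0 h0.
- by move=> a y z yE zE; rewrite gl hl yE zE.
- apply/closed_nrP => y yS; apply/eqP; rewrite -subr_eq0.
  apply/eqP/nr_eps => e e0; have [|z /= zE yz] := yS (e / 2); first lra.
  have := star_hom_contractive gP (y - z).
  have := star_hom_contractive hP (z - y).
  rewrite (linear_funB gl) (linear_funB hl) (nr_distC z) zE.
  have := nr_dist_add (h z) (g y) (h y); lra.
- by move=> y z yE zE; rewrite gM hM yE zE.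
- by move=> y yE; rewrite gs hs yE.
Qed.

(** * Extension of isometric correspondences *)

Section IsometricExtension.
Variables (R : realType) (X : Type) (A B : cstarAlgType R).
Variables (f : X -> A) (g : X -> B).
Hypothesis fg : forall t, nr (teval f t) = nr (teval g t).

(** Viewing a pair as a family over [bool] makes the graph a [term_closure], whose stability under
    the operations is already proved. *)
Let AB (b : bool) : cstarAlgType R := if b then A else B.
Let fgAB (b : bool) : X -> AB b := if b return X -> AB b then f else g.
Let pairAB (x : A) (y : B) (b : bool) : AB b :=
  if b return AB b then x else y.

(* The closure of the graph of [teval f t |-> teval g t]. *)
Definition ext_graph (x : A) (y : B) := term_closure fgAB (pairAB x y).

Lemma ext_graphP x y : ext_graph x y <-> forall e : R, 0 < e ->
  exists t, nr (x - teval f t) <= e /\ nr (y - teval g t) <= e.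
Proof.
split=> [[_ xy] e /xy[t tP]|xy].
  by exists t; split; [exact: (tP true)|exact: (tP false)].
split.
  exists (nr x + nr y) => -[] /=; first by rewrite lerDl nr_ge0.
  by rewrite lerDr nr_ge0.
by move=> e /xy[t [xt yt]]; exists t => -[].
Qed.

Lemma ext_graph_var z : ext_graph (f z) (g z).
Proof.
apply/ext_graphP => e e0; exists (TVar R z).
by rewrite /= !subrr !nr0 ltW.
Qed.

Lemma ext_graph_lin (a : R[i]) x x' y y' : ext_graph x y -> ext_graph x' y' ->
  ext_graph (a *: x + x') (a *: y + y').
Proof.
move=> xy xy'; apply: eq_term_closure (term_closure_lin a xy xy').
by case.
Qed.

Lemma ext_graph_mul x x' y y' : ext_graph x y -> ext_graph x' y' ->
  ext_graph (x ** x') (y ** y').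
Proof.
by move=> xy xy'; apply: eq_term_closure (term_closure_mul xy xy'); case.
Qed.

Lemma ext_graph_star x y : ext_graph x y -> ext_graph (star x) (star y).
Proof.
by move=> xy; apply: eq_term_closure (term_closure_star xy); case.
Qed.

(** Two terms approximating [x] have close values under [f], hence under [g], by [fg] at their
    difference. Four errors of [e / 4] add up. *)
Lemma ext_graph_fun x y y' : ext_graph x y -> ext_graph x y' -> y = y'.
Proof.
move=> /ext_graphP xy /ext_graphP xy'.
apply/eqP; rewrite -subr_eq0; apply/eqP/nr_eps => e e0.
have e4 : 0 < e / 4 by lra.
have [t [xt yt]] := xy _ e4; have [u [xu yu]] := xy' _ e4.
have := fg (TLin (-1) u t); rewrite /= !scaleN1r.
rewrite [- teval f u + _]addrC [- teval g u + _]addrC.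
have := nr_dist_add x (teval f t) (teval f u).
rewrite (nr_distC (teval f t) x).
have := nr_dist_add (teval g t) y y'.
have := nr_dist_add (teval g u) (teval g t) y'.
rewrite (nr_distC (teval g u) y'); lra.
Qed.

(** By [fg], terms whose values under [f] converge to [x] have Cauchy values under [g]; [y] is their
    limit in [B]. *)
Lemma ext_graph_total x :
  (forall e : R, 0 < e -> exists t, nr (x - teval f t) <= e) ->
  exists y, ext_graph x y.
Proof.
move=> xt.
have inv_gt0 n : 0 < n.+1%:R^-1 :> R by rewrite invr_gt0.
have [t tP] := choice (fun n => xt _ (inv_gt0 n)).
have small (e : R) : 0 < e -> exists N : nat, forall n, (N <= n)%N ->
    nr (x - teval f (t n)) <= e.
  move=> e0; have [N _ NP] := near_infty_natSinv_lt (PosNum e0).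
  by exists N => n Nn; rewrite (le_trans (tP n))// ltW// NP.
have [e e0|y yP] := @cauchy_seq_lim R B (fun n => teval g (t n)).
  have e2 : 0 < e / 2 by lra.
  have [N NP] := small _ e2; exists N => m n Nm Nn.
  have := fg (TLin (-1) (t n) (t m)); rewrite /= !scaleN1r.
  rewrite addrC [- teval g _ + _]addrC => <-.
  have := nr_dist_add x (teval f (t m)) (teval f (t n)).
  rewrite (nr_distC (teval f (t m)) x); have := NP _ Nm; have := NP _ Nn; lra.
exists y; apply/ext_graphP => e e0.
have [N NP] := small _ e0; have [M MP] := yP _ e0.
exists (t (maxn M N)); rewrite NP ?leq_maxr//; split => //.
by rewrite nr_distC MP// leq_maxl.
Qed.

End IsometricExtension.

(** * The universal C*-algebra *)

Section JCTripleTheory.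
Variables (R : realType) (E : jcTripleType R).

(** The embedding inverts the realization [phi], which is injective on [F] because it is isometric
    there. Each identity for [psi] is checked after applying [phi], once both sides are known to lie
    in [F]. *)
Lemma jctriple_embedding : exists (A : cstarAlgType R) (psi : E -> A),
  is_triple_hom psi /\ forall x, nr (psi x) = nr x.
Proof.
have [A [T [F [phi [_ [_ [F0 Flin _] Ftr] [philin phinr phiS phitr]]]]]] :=
  @jctriple_realizable R E.
have psiP x : exists y, F y /\ phi y = x.
  have : (phi @` F) x by rewrite phiS.
  by move=> [y Fy yx]; exists y.
have [psi {}psiP] := choice psiP.
have psiF x := (psiP x).1; have psiK x := (psiP x).2.
have phi_inj u v : F u -> F v -> phi u = phi v -> u = v.
  move=> Fu Fv uv; apply/eqP; rewrite -subr_eq0 -normr_eq0.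
  rewrite addrC -scaleN1r -phinr; last exact: Flin.
  by rewrite philin// uv scaleN1r addNr normr0.
exists A, psi; split; last first.
  by move=> x; rewrite /nr -phinr ?psiK.
split=> [a x y|a b c]; apply: phi_inj => //.
- exact: Flin.
- by rewrite philin// !psiK.
- exact: Ftr.
- by rewrite -phitr// !psiK.
Qed.

(** The norm bound and additivity required of [jctriple] are pulled back from [cstar_triple] along
    the isometric embedding. *)
Lemma triple_hom_nr_le (A : cstarAlgType R) (f : E -> A) :
  is_triple_hom f -> forall x, nr (f x) <= nr x.
Proof.
move=> [fl ftr]; have [B [psi [[psil psitr] psinr]]] := jctriple_embedding.
apply: (@triple_hom_contractive _ _ jctriple) => //.
- by move=> a b c; rewrite -!psinr psitr; exact: nr_cstar_triple.
- move=> a b c d; have psi_inj u v : psi u = psi v -> u = v.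
    move=> uv; apply/eqP; rewrite -subr_eq0; apply/eqP/nr0_eq0.
    by rewrite -psinr (linear_funB psil) uv subrr nr0.
  apply: psi_inj.
  by rewrite (linear_funB psil) !psitr (linear_funB psil) cstar_tripleB.
Qed.

(* The algebras [A] range over a large type, but the seminorms induced on terms
   form a small one; [hom_map] picks one homomorphism for each seminorm. *)
Definition hom_index : Type := {n : sterm R E -> R | exists (A : cstarAlgType R),
  exists2 f : E -> A, is_triple_hom f & forall t, nr (teval f t) = n t}.

Definition hom_alg (i : hom_index) : cstarAlgType R := projT1 (cid (projT2 i)).

Lemma hom_map_subproof (i : hom_index) : exists f : E -> hom_alg i,
  is_triple_hom f /\ forall t, nr (teval f t) = projT1 i t.
Proof. by rewrite /hom_alg; case: cid => A [f fP fi]; exists f. Qed.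

Definition hom_map (i : hom_index) : E -> hom_alg i :=
  projT1 (cid (hom_map_subproof i)).

Lemma hom_map_triple_hom i : is_triple_hom (hom_map i).
Proof. exact: (projT2 (cid (hom_map_subproof i))).1. Qed.

(** The homomorphism picked at this index may differ from [f], even in its target; only the seminorm
    is shared. *)
Lemma hom_index_ex (A : cstarAlgType R) (f : E -> A) : is_triple_hom f ->
  exists i, forall t, nr (teval (hom_map i) t) = nr (teval f t).
Proof.
move=> fP; exists (exist _ (fun t => nr (teval f t))
  (ex_intro _ A (ex_intro2 _ _ f fP (fun=> erefl)))).
exact: (projT2 (cid (hom_map_subproof _))).2.
Qed.

Definition universal_alg : cstarAlgType R := gen_alg hom_map.

Lemma universal_map_subproof (x : E) :
  term_closure hom_map (fun i => hom_map i x).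
Proof.
(* Contractivity gives one bound for all coordinates, whatever their targets. *)
split; first by exists (nr x) => i;
  exact: triple_hom_nr_le (hom_map_triple_hom i) x.
by move=> e e0; exists (TVar R x) => i /=; rewrite subrr nr0 ltW.
Qed.

Definition universal_map (x : E) : universal_alg :=
  GenAlg (universal_map_subproof x).

Lemma universal_map_teval t i :
  (teval universal_map t : gen_alg hom_map) i = teval (hom_map i) t.
Proof.
elim: t => //= [a t IHt u IHu|t IHt u IHu|t IHt]; by rewrite -?IHt -?IHu.
Qed.

Lemma universal_map_triple_hom : is_triple_hom universal_map.
Proof.
split=> [a x y|a b c]; apply: ga_eq => i.
  exact: (hom_map_triple_hom i).1.
exact: (hom_map_triple_hom i).2.
Qed.

Lemma universal_map_inj : injective universal_map.
Proof.
move=> x y xy; have [A [psi [psiP psinr]]] := jctriple_embedding.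
have [i iP] := hom_index_ex psiP.
have hi : hom_map i x = hom_map i y.
  by rewrite -[LHS]/((universal_map x : gen_alg hom_map) i) xy.
apply/eqP; rewrite -subr_eq0; apply/eqP/nr0_eq0.
(* The formal difference of [x] and [y] vanishes under [hom_map i], hence under the isometric
   [psi]. *)
have := iP (TLin (-1) (TVar R y) (TVar R x)).
rewrite /= hi scaleN1r addNr nr0 => /esym.
by rewrite scaleN1r addrC -(linear_funB psiP.1) psinr.
Qed.

Lemma universal_map_dense (x : universal_alg) (e : R) : 0 < e ->
  exists t, nr (x - teval universal_map t) <= e.
Proof.
move=> e0; have [t tP] := (ga_closure x).2 e e0; exists t.
apply/ga_norm_bound; first exact: ltW.
by move=> i; move: (tP i); rewrite -universal_map_teval.
Qed.

Lemma universal_map_generates : cstar_generated (range universal_map) = setT.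
Proof.
apply/seteqP; split => // x _ S [[[S0 Slin Scl] SM Sstar] rS].
apply: (closed_nrP S).1 => // e /universal_map_dense-/(_ x)[t xt].
exists (teval universal_map t) => //.
elim: t {xt} => /= [y||a t IHt u IHu|t IHt u IHu|t IHt]; rewrite ?rS; auto.
Qed.

(** The extension takes the coordinate at [i] and follows the closed graph from values under
    [hom_map i] to values under [f]. Every algebraic law holds because the graph is stable under the
    operation and single-valued. *)
Lemma universal_map_extends (A : cstarAlgType R) (f : E -> A) :
  is_triple_hom f ->
  exists g : universal_alg -> A, is_star_hom g /\ g \o universal_map = f.
Proof.
move=> fP; have [i iP] := hom_index_ex fP.
have exy (x : gen_alg hom_map) : exists y, ext_graph (hom_map i) f (x i) y.
  apply: (ext_graph_total iP) => e /(ga_closure x).2[t tP]; exists t; exact: tP.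
have [g gP] := choice exy; have graph_fun := ext_graph_fun iP.
exists g; split; last first.
  apply/funext => x; apply: graph_fun (gP _) _; exact: ext_graph_var.
split.
- move=> a x y; apply: graph_fun (gP _) _; exact: ext_graph_lin.
- move=> x y; apply: graph_fun (gP _) _; exact: ext_graph_mul.
- move=> x; apply: graph_fun (gP _) _; exact: ext_graph_star.
Qed.

Lemma universal_map_universal : is_universal_cstar universal_map.
Proof.
split; first by split; [exact: universal_map_triple_hom|exact: universal_map_inj].
  exact: universal_map_generates.
move=> A f fP; have [g gP] := universal_map_extends fP; exists g; split => //.
move=> h [hP hf].
apply: (star_hom_eq_on_generators universal_map_generates gP.1 hP).
by move=> _ [x _ <-]; rewrite -[LHS]/((g \o universal_map) x) gP.2 -hf.
Qed.

(** * Uniqueness of the universal pair *)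

Lemma is_star_hom_id (A : cstarAlgType R) : is_star_hom (@id A).
Proof. by []. Qed.

Lemma is_star_hom_comp (A B C : cstarAlgType R) (g : A -> B) (h : B -> C) :
  is_star_hom g -> is_star_hom h -> is_star_hom (h \o g).
Proof.
move=> [gl gM gs] [hl hM hs]; split=> [a x y|x y|x] /=.
- by rewrite gl hl.
- by rewrite gM hM.
- by rewrite gs hs.
Qed.

(** Each composite of the two comparison maps extends the same embedding as the identity does, so
    uniqueness of extensions identifies them. *)
Lemma universal_cstar_iso (C B : cstarAlgType R)
    (alpha : E -> C) (beta : E -> B) :
  is_universal_cstar alpha -> is_universal_cstar beta ->
  exists theta : C -> B, is_star_iso theta /\ theta \o alpha = beta.
Proof.
move=> [[alphaP _] _ Cuniv] [[betaP _] _ Buniv].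
have [th [[thP tha] _]] := Cuniv _ _ betaP.
have [et [[etP etb] _]] := Buniv _ _ alphaP.
exists th; split => //; split => //; exists et => x.
- have [k [_ kU]] := Cuniv _ _ alphaP.
  rewrite -[LHS]/((et \o th) x) -(kU (et \o th)).
    by rewrite (kU id)//; split => //; exact: is_star_hom_id.
  by split; [exact: is_star_hom_comp|rewrite -compA tha].
- have [k [_ kU]] := Buniv _ _ betaP.
  rewrite -[LHS]/((th \o et) x) -(kU (th \o et)).
    by rewrite (kU id)//; split => //; exact: is_star_hom_id.
  by split; [exact: is_star_hom_comp|rewrite -compA etb].
Qed.

End JCTripleTheory.

Theorem theorem3p1 (R : realType) (E : jcTripleType R) :
  exists (C : cstarAlgType R) (alpha : E -> C),
    is_universal_cstar alpha /\
    forall (B : cstarAlgType R) (beta : E -> B), is_universal_cstar beta ->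
      exists theta : C -> B, is_star_iso theta /\ theta \o alpha = beta.
Proof.
exists (universal_alg E), (@universal_map R E); split.
  exact: universal_map_universal.
by move=> B beta; apply: universal_cstar_iso; exact: universal_map_universal.
Qed.
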